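(* Let $\boldsymbol{\mu}_+\ne\boldsymbol{\mu}_-\in\mathbb{R}^d$, $\sigma>0$, and let $(\boldsymbol{X},Y)$ be random with $P(Y=+)=P(Y=-)=1/2$ and $\boldsymbol{X}\mid Y=i\sim N(\boldsymbol{\mu}_i,\sigma^2\boldsymbol{I}_d)$. Let $\boldsymbol{w}\in\mathbb{R}^d\setminus\{\boldsymbol{0}\}$, $b\in\mathbb{R}$, and let the linear classifier assign $\boldsymbol{x}$ to class $+$ iff $\boldsymbol{w}\cdot\boldsymbol{x}+b>0$. Let $\varepsilon>0$, $\delta\ge0$. Put $\boldsymbol{\mu}=\frac12(\boldsymbol{\mu}_+-\boldsymbol{\mu}_-)$, $\bar{\boldsymbol{\mu}}=\frac12(\boldsymbol{\mu}_++\boldsymbol{\mu}_-)$, $b'=\boldsymbol{w}\cdot\bar{\boldsymbol{\mu}}+b$, $\boldsymbol{\mu}_0=\boldsymbol{\mu}/\|\boldsymbol{\mu}\|$, let $\theta\in[0,\pi/2]$ be defined by $\cos\theta=|\boldsymbol{w}\cdot\boldsymbol{\mu}_0|/\|\boldsymbol{w}\|$, let $\beta=\min(\varepsilon\cos\theta,\delta)$ and $$g(\varepsilon,\delta,\theta)=\beta\cos\theta+\sqrt{\varepsilon^2-\beta^2}\,\sin\theta.$$ Let $p_m$ be the probability that $\boldsymbol{X}$ is misclassified and $p_{s-adv}$ the probability that $\boldsymbol{X}$ is correctly classified and has an $(\varepsilon,\delta)$-strong-adversarial example. Then $$p_{s-adv}=1-p_m-\frac12\left[\Phi\!\left(\frac{\boldsymbol{w}\cdot\boldsymbol{\mu}+b'}{\|\boldsymbol{w}\|\sigma}-\frac{g(\varepsilon,\delta,\theta)}{\sigma}\right)+\Phi\!\left(\frac{\boldsymbol{w}\cdot\boldsymbol{\mu}-b'}{\|\boldsymbol{w}\|\sigma}-\frac{g(\varepsilon,\delta,\theta)}{\sigma}\right)\right],$$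 and consequently $$p_{s-adv}+p_m=1-\frac12\left[\Phi\!\left(\frac{\boldsymbol{w}\cdot\boldsymbol{\mu}+b'}{\|\boldsymbol{w}\|\sigma}-\frac{g(\varepsilon,\delta,\theta)}{\sigma}\right)+\Phi\!\left(\frac{\boldsymbol{w}\cdot\boldsymbol{\mu}-b'}{\|\boldsymbol{w}\|\sigma}-\frac{g(\varepsilon,\delta,\theta)}{\sigma}\right)\right].$$
   Context: $\Phi$ is the standard normal CDF, $\|\cdot\|$ the Euclidean norm. An $(\varepsilon,\delta)$-strong-adversarial example of $\boldsymbol{x}$ is a point $\boldsymbol{x}'$ with $\|\boldsymbol{x}-\boldsymbol{x}'\|\le\varepsilon$ and $|(\boldsymbol{x}-\boldsymbol{x}')\cdot\boldsymbol{\mu}_0|\le\delta$ that the classifier assigns to a different class than $\boldsymbol{x}$. The angle $\theta$ is the (acute) angle between $\boldsymbol{w}$ and the line spanned by $\boldsymbol{\mu}_0$. *)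

(* Defs.v *)
From HB Require Import structures.
From mathcomp Require Import all_boot all_order all_algebra.
From mathcomp Require Import all_classical all_reals all_analysis.
Set Implicit Arguments. Unset Strict Implicit. Unset Printing Implicit Defensive.
Import Order.TTheory GRing.Theory Num.Theory.
Local Open Scope classical_set_scope.
Local Open Scope ring_scope.

Section Defs.
Variable R : realType.

Definition dotv (d : nat) (u v : 'rV[R]_d) : R := \sum_(k < d) u 0 k * v 0 k.
Definition enorm (d : nat) (v : 'rV[R]_d) : R := Num.sqrt (dotv v v).

Definition Phi (x : R) : R := fine (normal_prob 0 1 `]-oo, x]).

Definition lin_cls (d : nat) (w : 'rV[R]_d) (b : R) (x : 'rV[R]_d) : bool :=
  0 < dotv w x + b.

Definition strong_adv (d : nat) (w : 'rV[R]_d) (b : R) (mu0 : 'rV[R]_d)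
  (eps delta : R) (x x' : 'rV[R]_d) : Prop :=
  enorm (x - x') <= eps /\ `|dotv (x - x') mu0| <= delta /\
  lin_cls w b x' != lin_cls w b x.

(* Y (a bool-valued label) and the coordinates Z_1..Z_d are mutually
   independent: product rule for all events (taking A k = setT gives every
   subfamily). *)
Definition indep_label_coords (dT : measure_display) (T : measurableType dT)
  (P : probability T R) (d : nat) (Y : T -> bool) (Z : 'I_d -> T -> R) : Prop :=
  forall (B : set bool) (A : 'I_d -> set R), (forall k, measurable (A k)) ->
  P (Y @^-1` B `&` \bigcap_(k in [set: 'I_d]) (Z k @^-1` A k)) =
  (P (Y @^-1` B) * \prod_(k < d) P (Z k @^-1` A k))%E.

Definition g_fun (eps delta theta : R) : R :=
  let beta := Num.min (eps * cos theta) delta in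
  beta * cos theta + Num.sqrt (eps ^+ 2 - beta ^+ 2) * sin theta.

End Defs.

(* Main.v *)
(* Write [G = |w| * g].  Among the vectors [v] with [|v| <= eps] and
   [|v . mu0| <= delta] the maximum of [w . v] is attained and equals [G], so a
   point with score [w . x + b > 0] has an adversarial example iff its score is
   at most [G], and one with score [<= 0] iff its score exceeds [- G].  Hence,
   being misclassified or having an adversarial example amounts to a score
   [<= G] on class [+] and a score [> - G] on class [-].  Given the class, the
   score is an affine function of [w . Z], whose law is [N(0, |w|^2)]: this
   follows from the rotation invariance of the product of two standard normal
   laws by adding one coordinate at a time, while keeping track of the joint law
   with the remaining coordinates. *)

Require Import Defs.
From HB Require Import structures.
From mathcomp Require Import all_boot all_order all_algebra.
From mathcomp Require Import all_classical all_reals all_analysis.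
From mathcomp Require Import measurable_realfun ring lra.
Import Order.TTheory GRing.Theory Num.Theory.
Local Open Scope classical_set_scope.
Local Open Scope ring_scope.
Set Implicit Arguments.
Unset Strict Implicit.
Unset Printing Implicit Defensive.

(** * Standard normal laws *)

Lemma measurable_affine (R : realType) (s m : R) :
  measurable_fun [set: measurableTypeR R]
    ((fun x => s * x + m) : measurableTypeR R -> measurableTypeR R).
Proof. by apply: measurable_funD => //; exact: measurable_funM. Qed.

(** By uniqueness of Lebesgue measure, the scaled pushforward [nu] need only be compared with it on
    half-open intervals. *)
Lemma lebesgue_measure_affine (R : realType) (s m : R) (A : set R) : s != 0 ->
  measurable A ->
  lebesgue_measure A = (`|s|%:E *
    lebesgue_measure ((fun x => s * x + m)%R @^-1` A))%E :> \bar R.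
Proof.
move=> s0 mA.
pose f : measurableTypeR R -> measurableTypeR R := fun x => s * x + m.
pose nu := mscale (NngNum (normr_ge0 s)) (pushforward (@lebesgue_measure R) f).
rewrite -[RHS]/(nu (measurable_affine s m) A).
apply: lebesgue_measure_unique => // _ [[a b]] _ <-.
rewrite /nu -[RHS]/(`|s|%:E *
  lebesgue_measure ((fun x => s * x + m)%R @^-1` [set` `]a, b]]))%E.
have [s_gt0|s_lt0] : 0 < s \/ s < 0 by lra.
- rewrite (_ : _ @^-1` _ = `](a - m) / s, (b - m) / s]%classic); last first.
    apply/seteqP; split => x /=; rewrite !in_itv/= ltr_pdivrMr// ler_pdivlMr//;
    lra.
  rewrite !lebesgue_measure_itv/= !lte_fin ltr_pM2r ?invr_gt0// ltrD2r.
  case: ifPn => _; last by rewrite mule0.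
  by rewrite -!EFinD -EFinM gtr0_norm//; congr EFin; field.
- rewrite (_ : _ @^-1` _ = `[(b - m) / s, (a - m) / s[%classic); last first.
    apply/seteqP; split => x /=; rewrite !in_itv/= ltr_ndivlMr// ler_ndivrMr//;
    lra.
  rewrite !lebesgue_measure_itv/= !lte_fin ltr_nM2r ?invr_lt0// ltrD2r.
  case: ifPn => _; last by rewrite mule0.
  by rewrite -!EFinD -EFinM ltr0_norm//; congr EFin; field.
Qed.

(* [s] may be negative since [normal_pdf m s] only depends on [s ^+ 2]. *)
Lemma normal_prob_affine (R : realType) (s m : R) (A : set R) : s != 0 ->
  measurable A ->
  normal_prob 0 1 ((fun x => s * x + m) @^-1` A) = normal_prob m s A.
Proof.
move=> s0 mA.
pose f : measurableTypeR R -> measurableTypeR R := fun x => s * x + m.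
have mf : measurable_fun setT f := measurable_affine s m.
have mfA : measurable (f @^-1` A) by rewrite -[f @^-1` A]setTI; exact: mf.
have mp : measurable_fun [set: R] (EFin \o normal_pdf m s).
  by apply/measurable_EFinP; exact: measurable_normal_pdf.
pose nu := mscale (NngNum (normr_ge0 s)) (pushforward (@lebesgue_measure R) f).
rewrite /normal_prob.
(* The density of N(0, 1) at [x] is |s| times that of N(m, s^2) at [f x]. This Jacobian factor is
   the weight of [nu], which is Lebesgue measure again. *)
transitivity (`|s|%:E * \int[lebesgue_measure]_(x in f @^-1` A)
   (normal_pdf m s (f x))%:E)%E.
  rewrite -ge0_integralZl//; last 2 first.
  - exact/measurable_funTS/(measurableT_comp mp).
  - by move=> x _; rewrite lee_fin normal_pdf_ge0.
  apply: eq_integral => x _; rewrite -EFinM; congr EFin.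
  rewrite !normal_pdfE ?oner_neq0//= /normal_fun /normal_peak /f.
  rewrite -!(mulrnAr _ pi) sqrtrM ?sqr_ge0// [in RHS]sqrtrM ?sqr_ge0//.
  rewrite !sqrtr_sqr normr1 !mul1r.
  rewrite invfM mulrA mulrA divff ?normr_eq0// mul1r.
  by congr (_ * expR _); field.
rewrite -(@ge0_integral_pushforward _ _ _ _ _ _ mf _ A
  (EFin \o normal_pdf m s))//=; last 2 first.
- exact: measurable_funTS.
- by move=> x _; rewrite lee_fin normal_pdf_ge0.
transitivity (\int[nu mf]_(x in A) (normal_pdf m s x)%:E)%E; last first.
  apply: eq_measure_integral => B mB _; rewrite /nu /mscale /pushforward/=.
  exact/esym/(lebesgue_measure_affine m s0 mB).
rewrite ge0_integral_mscale//=.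
- exact: measurable_funTS.
- by move=> x _; rewrite lee_fin normal_pdf_ge0.
Qed.

(** The density agrees almost everywhere with the Radon-Nikodym derivative, since both have the same
    integral over every measurable set. *)
Lemma integral_normal_prob (R : realType) (m s : R) (f : R -> \bar R) :
  (normal_prob m s).-integrable setT f ->
  (\int[normal_prob m s]_x f x =
   \int[lebesgue_measure]_x (f x * (normal_pdf m s x)%:E))%E.
Proof.
move=> fi.
have mf := measurable_int _ fi.
have dom := @normal_prob_dominates R m s.
pose nu := charge_of_finite_measure (normal_prob m s).
have dom' : nu `<< lebesgue_measure by exact: dom.
have RNi := Radon_Nikodym_integrable dom'.
rewrite -(Radon_Nikodym_change_of_variables dom)//=.
apply: ae_eq_integral => //.
- apply: emeasurable_funM => //; exact: (measurable_int _ RNi).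
- apply: emeasurable_funM => //=; apply/measurableT_comp => //=.
  exact: measurable_normal_pdf.
- apply: ae_eqe_mul2l => /=.
  apply: integral_ae_eq => //=.
  + by apply/measurableT_comp => //; exact: measurable_normal_pdf.
  + by move=> E _ mE; rewrite -(Radon_Nikodym_integral dom').
Qed.

(** Both sides are the joint density of x and u = s x + a y for independent standard normal x and y:
    its exponent -(u^2 - 2 s u x + x^2) / (2 a^2) is symmetric in x and u. *)
Lemma normal_pdf_rotation (R : realType) (s a x u : R) :
  a != 0 -> s ^+ 2 + a ^+ 2 = 1 ->
  normal_pdf (s * x) a u * normal_pdf 0 1 x =
  normal_pdf 0 1 u * normal_pdf (s * u) a x.
Proof.
move=> a0 sa1; rewrite !normal_pdfE ?oner_neq0// mulrACA [RHS]mulrACA.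
rewrite (mulrC (normal_peak a)); congr (_ * _); rewrite -!expRD; congr expR.
have -> : (u - s * x) ^+ 2 = (x - s * u) ^+ 2 + (u ^+ 2 - x ^+ 2) * a ^+ 2.
  by have -> : a ^+ 2 = 1 - s ^+ 2; [lra|ring].
by field.
Qed.

Lemma measurable_lincomb (R : realType) (s a : R) :
  measurable_fun [set: measurableTypeR R * measurableTypeR R]
    ((fun z => s * z.1 + a * z.2) :
      measurableTypeR R * measurableTypeR R -> measurableTypeR R).
Proof.
by apply: measurable_funD; exact: measurable_funM.
Qed.

(** Given the first coordinate x, the combination u has law N(s x, a^2). Writing the joint density
    conditionally on u instead and integrating out x first leaves the standard normal density of
    u. *)
Lemma normal_prob_rotation (R : realType) (s a : R) (A : set R) :
  s ^+ 2 + a ^+ 2 = 1 -> measurable A ->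
  (normal_prob 0 1 \x normal_prob 0 1)%E
    ((fun z : R * R => s * z.1 + a * z.2) @^-1` A) = normal_prob 0 1 A.
Proof.
move=> sa1 mA.
(* For [a = 0] there is no conditional density; then [s] is 1 or -1 and symmetry suffices. *)
have [a0|a0] := eqVneq a 0.
  have s0 : s != 0 by apply/eqP => s0; move: sa1; rewrite s0 a0; lra.
  have -> : (fun z : R * R => s * z.1 + a * z.2) @^-1` A =
      ((fun x => s * x + 0) @^-1` A) `*` setT.
    by rewrite a0; apply/seteqP; split=> -[x y]/=; rewrite mul0r; tauto.
  have mf := @measurable_affine R s 0.
  rewrite product_measure1E//; last by rewrite -[_ @^-1` _]setTI; exact: mf.
  rewrite -[RHS]mule1; congr (_ * _)%E; last first.
    exact: (@probability_setT _ _ _ (normal_prob 0 1)).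
  apply: (etrans (normal_prob_affine 0 s0 mA)).
  apply: eq_integral => x _; congr EFin; rewrite !normal_pdfE ?oner_neq0//.
  have s2 : s ^+ 2 = 1 by rewrite a0 in sa1; lra.
  by rewrite /normal_fun /normal_peak s2 expr1n.
have mC := @measurable_lincomb R s a.
have secE x : xsection ((fun z : R * R => s * z.1 + a * z.2) @^-1` A) x =
    (fun y => a * y + s * x) @^-1` A.
  by apply/seteqP; split => y /=; rewrite /xsection/= inE/= addrC.
rewrite /product_measure1/=.
transitivity (\int[normal_prob 0 1]_x normal_prob (s * x) a A)%E.
  by apply: eq_integral => x _; rewrite /= secE; exact: normal_prob_affine.
have mh : measurable_fun [set: measurableTypeR R]
    (fun x : measurableTypeR R => normal_prob (s * x) a A).
  rewrite (_ : (fun _ => _) = normal_prob 0 1 \o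
      xsection ((fun z : R * R => s * z.1 + a * z.2) @^-1` A)).
    by apply: measurable_fun_xsection; rewrite -[_ @^-1` _]setTI; exact: mC.
  by apply/funext => x/=; rewrite secE normal_prob_affine.
have hi : (normal_prob 0 1).-integrable setT (fun x => normal_prob (s * x) a A).
  apply: (@le_integrable _ _ _ (normal_prob 0 1) _ measurableT _ (cst 1%E)).
  - exact: mh.
  - move=> x _; rewrite [leRHS]abse1 gee0_abs ?measure_ge0//.
    exact: (@probability_le1 _ _ _ (normal_prob (s * x) a)).
  - exact: finite_measure_integrable_cst.
rewrite (integral_normal_prob hi).
pose F (z : measurableTypeR R * measurableTypeR R) : \bar R :=
  (\1_A z.2 * (normal_pdf 0 1 z.2 * normal_pdf (s * z.2) a z.1))%:E.
have mpa m : measurable_fun [set: R] (normal_pdf m a).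
  exact: measurable_normal_pdf.
have mF : measurable_fun setT F.
  apply/measurable_EFinP/measurable_funM.
    have mi : measurable_fun [set: measurableTypeR R] (\1_A : R -> R).
      exact: measurable_indic.
    exact: (measurableT_comp mi).
  apply: measurable_funM.
    exact: (measurableT_comp (measurable_normal_pdf 0 1) measurable_snd).
  rewrite (_ : (fun z => _) = normal_pdf 0 a \o
      (fun z : measurableTypeR R * measurableTypeR R => z.1 - s * z.2)).
    apply: (measurableT_comp (mpa 0)); apply: measurable_funB => //.
    exact: measurable_funM.
  by apply/funext => z; rewrite !normal_pdfE//= /normal_fun subr0.
have F0 z : (0 <= F z)%E by rewrite lee_fin !mulr_ge0// normal_pdf_ge0.
transitivity (\int[lebesgue_measure]_x \int[lebesgue_measure]_u F (x, u))%E.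
  apply: eq_integral => x _.
  rewrite /normal_prob integral_mkcond muleC -ge0_integralZl//; last 3 first.
  - apply/(measurable_restrictT _ mA)/measurable_funTS/measurable_EFinP.
    exact: mpa.
  - by move=> u _; rewrite patchE; case: ifPn; rewrite // lee_fin normal_pdf_ge0.
  - by rewrite lee_fin normal_pdf_ge0.
  apply: eq_integral => u _; rewrite /F/= -normal_pdf_rotation// patchE indicE.
  by case: ifPn => _; rewrite ?mule0 ?mul0r// mul1r -EFinM mulrC.
(* After the exchange the inner integral over [x] is that of a normal density centred at [s * u],
   hence 1. *)
rewrite (fubini_tonelli F mF F0).
transitivity (\int[lebesgue_measure]_u (\1_A u * normal_pdf 0 1 u)%:E)%E.
  apply: eq_integral => u _.
  under eq_integral do rewrite /F/= mulrA EFinM.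
  rewrite ge0_integralZl//; last 3 first.
  - by apply/measurable_EFinP; exact: mpa.
  - by move=> x _; rewrite lee_fin normal_pdf_ge0.
  - by rewrite lee_fin mulr_ge0// normal_pdf_ge0.
  by rewrite integral_normal_pdf mule1.
rewrite /normal_prob [RHS]integral_mkcond; apply: eq_integral => u _.
by rewrite patchE indicE; case: ifPn => _; rewrite ?mul1r// mul0r.
Qed.

(** Dividing both coefficients by [r] reduces to the unit case; [r = 0] forces both to vanish, and
    the events are then full or empty. *)
Lemma normal_prob_lincomb (R : realType) (s a : R) (A : set R) : measurable A ->
  (normal_prob 0 1 \x normal_prob 0 1)%E
    ((fun z : R * R => s * z.1 + a * z.2) @^-1` A) =
  normal_prob 0 1 ((fun z => Num.sqrt (s ^+ 2 + a ^+ 2) * z) @^-1` A).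
Proof.
move=> mA; set r := Num.sqrt _.
have r2 : r ^+ 2 = s ^+ 2 + a ^+ 2 by rewrite sqr_sqrtr// addr_ge0 ?sqr_ge0.
have [r0|r0] := eqVneq r 0.
  have s0 : s = 0.
    by apply/eqP; rewrite -sqrf_eq0; apply/eqP; move: (sqr_ge0 s) (sqr_ge0 a);
      rewrite r0 in r2; lra.
  have a0 : a = 0.
    by apply/eqP; rewrite -sqrf_eq0; apply/eqP; move: (sqr_ge0 s) (sqr_ge0 a);
      rewrite r0 in r2; lra.
  have -> : (fun z : R * R => s * z.1 + a * z.2) @^-1` A =
      ((fun z => r * z) @^-1` A) `*` setT.
    rewrite r0 s0 a0; apply/seteqP.
    by split=> -[x y]/=; rewrite !mul0r addr0; tauto.
  rewrite product_measure1E//; last first.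
    by rewrite -[_ @^-1` _]setTI; exact: (@measurable_funM _ _ _ _ (cst r) id).
  rewrite -[RHS]mule1; congr (_ * _)%E.
  exact: (@probability_setT _ _ _ (normal_prob 0 1)).
rewrite -(@normal_prob_rotation _ (s / r) (a / r)); last 2 first.
- by rewrite !expr_div_n -mulrDl -r2 divff// sqrf_eq0.
- by rewrite -[_ @^-1` _]setTI; exact: (@measurable_funM _ _ _ _ (cst r) id).
congr ((_ \x _)%E _); apply/seteqP; split=> -[x y]/=.
  by congr (A _); field.
by congr (A _); field.
Qed.

(** * The standard normal distribution function *)

Lemma normal_prob_PhiE (R : realType) (x : R) :
  normal_prob 0 1 `]-oo, x] = (Phi x)%:E.
Proof. by rewrite /Phi fineK// fin_num_measure. Qed.

Lemma normal_prob_PhiC (R : realType) (x : R) :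
  normal_prob 0 1 `]x, +oo[ = (1 - Phi x)%:E.
Proof.
rewrite -setCitvl (@probability_setC _ _ _ (normal_prob 0 1))//.
by rewrite EFinB -normal_prob_PhiE.
Qed.

Lemma normal_prob_set1 (R : realType) (x : R) : normal_prob 0 1 [set x] = 0%E.
Proof.
have /null_content_dominatesP := @normal_prob_dominates R 0 1.
by apply => //; exact: lebesgue_measure_set1.
Qed.

(** The law has no atoms, so the ray may be closed, and it is invariant under reflection, the affine
    map of slope -1. *)
Lemma PhiN (R : realType) (x : R) : Phi (- x) = 1 - Phi x.
Proof.
apply: EFin_inj; rewrite -normal_prob_PhiE -normal_prob_PhiC.
have -> : normal_prob 0 1 `]x, +oo[ = normal_prob 0 1 `[x, +oo[ :> \bar R.
  rewrite -[RHS](_ : normal_prob 0 1 ([set x] `|` `]x, +oo[) = _); last first.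
    by congr normal_prob; rewrite setU1itv// bnd_simp.
  rewrite measureU//.
    by rewrite -[LHS]add0e; congr (_ + _)%E; exact/esym/normal_prob_set1.
  by apply/seteqP; split => y //= [->]; rewrite in_itv/= ltxx.
have -> : `[x, +oo[%classic = (fun y => -1 * y + 0) @^-1` `]-oo, - x].
  by apply/seteqP; split => y /=; rewrite !in_itv/=; lra.
rewrite normal_prob_affine//.
apply: eq_integral => y _; rewrite !normal_pdfE ?oppr_eq0 ?oner_neq0//.
by rewrite /normal_fun /normal_peak sqrrN.
Qed.

(** * Strong adversarial examples of a linear classifier *)

Section Euclid.
Variables (R : realType) (d : nat).
Implicit Types u v w : 'rV[R]_d.

Lemma dotvC u v : dotv u v = dotv v u.
Proof. by apply: eq_bigr => i _; rewrite mulrC. Qed.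

Lemma dotvDr u v w : dotv u (v + w) = dotv u v + dotv u w.
Proof. by rewrite -big_split; apply: eq_bigr => i _; rewrite mxE mulrDr. Qed.

Lemma dotvZr a u v : dotv u (a *: v) = a * dotv u v.
Proof. by rewrite mulr_sumr; apply: eq_bigr => i _; rewrite mxE mulrCA. Qed.

Lemma dotvDl u v w : dotv (v + w) u = dotv v u + dotv w u.
Proof. by rewrite dotvC dotvDr !(dotvC u). Qed.

Lemma dotvZl a u v : dotv (a *: u) v = a * dotv u v.
Proof. by rewrite dotvC dotvZr dotvC. Qed.

Lemma dotvNr u v : dotv u (- v) = - dotv u v.
Proof. by rewrite -scaleN1r dotvZr mulN1r. Qed.

Lemma dotvNl u v : dotv (- u) v = - dotv u v.
Proof. by rewrite dotvC dotvNr dotvC. Qed.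

Lemma dotv_ge0 v : 0 <= dotv v v.
Proof. by apply: sumr_ge0 => i _; rewrite -expr2 sqr_ge0. Qed.

Lemma sqr_enorm v : enorm v ^+ 2 = dotv v v.
Proof. by rewrite sqr_sqrtr ?dotv_ge0. Qed.

Lemma enorm_ge0 v : 0 <= enorm v. Proof. exact: sqrtr_ge0. Qed.

Lemma enormN v : enorm (- v) = enorm v.
Proof. by rewrite /enorm dotvNl dotvNr opprK. Qed.

Lemma enorm_gt0 v : v != 0 -> 0 < enorm v.
Proof.
move=> v0; rewrite lt_neqAle enorm_ge0 andbT eq_sym sqrtr_eq0 -ltNge.
rewrite lt_neqAle dotv_ge0 andbT; apply: contra v0 => /eqP/esym v0.
apply/eqP/rowP => i; rewrite mxE; apply/eqP; rewrite -sqrf_eq0 expr2.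
by apply/eqP; apply: (psumr_eq0P _ v0) => // j _; rewrite -expr2 sqr_ge0.
Qed.

(** Cauchy-Schwarz, read off from the square norm of |v| u - |u| v, which equals 2 |u| |v| (|u| |v|
    - u . v). *)
Lemma dotv_le u v : dotv u v <= enorm u * enorm v.
Proof.
have [->|u0] := eqVneq u 0.
  rewrite /enorm (_ : dotv 0 v = 0) ?mulr_ge0 ?sqrtr_ge0//.
  by apply: big1 => i _; rewrite mxE mul0r.
have [->|v0] := eqVneq v 0.
  rewrite /enorm (_ : dotv u 0 = 0) ?mulr_ge0 ?sqrtr_ge0//.
  by apply: big1 => i _; rewrite mxE mulr0.
have nu := enorm_gt0 u0; have nv := enorm_gt0 v0.
have := dotv_ge0 (enorm v *: u - enorm u *: v).
rewrite !(dotvDl, dotvDr, dotvNl, dotvNr, dotvZl, dotvZr) -!sqr_enorm (dotvC v u).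
set p := enorm u; set q := enorm v; set t := dotv u v.
have -> : q * (q * p ^+ 2 - p * t) + (q * - (p * t) - p * - (p * q ^+ 2)) =
  2 * (p * q) * (p * q - t) by ring.
by rewrite pmulr_rge0 ?subr_ge0// !mulr_gt0.
Qed.

End Euclid.

(* With [c] and [s] the cosine and sine of [theta], the left-hand side is the
   largest component along [w / |w|] of a vector of length [eps] whose component
   along [mu0] is [a]; it increases in [a] up to [eps * c]. *)
Lemma g_fun_max (R : realType) (eps delta c s a : R) :
  0 <= eps -> 0 <= c -> 0 <= s -> c ^+ 2 + s ^+ 2 = 1 ->
  0 <= a -> a <= delta -> a <= eps ->
  c * a + s * Num.sqrt (eps ^+ 2 - a ^+ 2) <=
  Num.min (eps * c) delta * c +
    Num.sqrt (eps ^+ 2 - Num.min (eps * c) delta ^+ 2) * s.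
Proof.
move=> e0 c0 s0 cs1 a0 ad ae.
set A := Num.sqrt _.
have A0 : 0 <= A by exact: sqrtr_ge0.
have A2 : A ^+ 2 = eps ^+ 2 - a ^+ 2.
  by rewrite sqr_sqrtr// subr_ge0 ler_sqr.
(* If [eps * c <= delta], the right-hand side is [eps] and the bound is Cauchy-Schwarz in the plane.
   Otherwise [delta] is the active bound and [D] is the orthogonal length left over. *)
have [ecd|dec] := leP (eps * c) delta.
  have -> : eps ^+ 2 - (eps * c) ^+ 2 = (eps * s) ^+ 2.
    by rewrite !exprMn; have -> : s ^+ 2 = 1 - c ^+ 2; [lra|ring].
  rewrite sqrtr_sqr ger0_norm ?mulr_ge0//.
  have -> : eps * c * c + eps * s * s = eps by nra.
  rewrite -ler_sqr ?nnegrE ?addr_ge0 ?mulr_ge0//.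
  have -> : eps ^+ 2 = (c ^+ 2 + s ^+ 2) * (a ^+ 2 + A ^+ 2) by rewrite A2 cs1; ring.
  by have := sqr_ge0 (c * A - s * a); nra.
have d0 : 0 <= delta by lra.
have c1 : c <= 1 by nra.
have de : delta <= eps by nra.
set D := Num.sqrt _.
have D0 : 0 <= D by exact: sqrtr_ge0.
have D2 : D ^+ 2 = eps ^+ 2 - delta ^+ 2 by rewrite sqr_sqrtr// subr_ge0 ler_sqr.
have DE : eps * s <= D.
  rewrite -ler_sqr ?nnegrE ?mulr_ge0// D2.
  have -> : (eps * s) ^+ 2 = eps ^+ 2 - (eps * c) ^+ 2.
    by rewrite !exprMn; have -> : s ^+ 2 = 1 - c ^+ 2; [lra|ring].
  by rewrite lerD2l lerN2 ler_sqr ?nnegrE ?mulr_ge0// ltW.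
have AD : D <= A by rewrite -ler_sqr ?nnegrE// A2 D2 lerD2l lerN2 ler_sqr.
(* Here [delta + a] is below [2 * (eps * c)], while [A + D] is at least [2 * (eps * s)]. *)
have h : s * (delta + a) <= c * (A + D).
  have h1 : s * (delta + a) <= s * (2 * (eps * c)) by apply: ler_wpM2l => //; lra.
  have h2 : c * (2 * (eps * s)) <= c * (A + D) by apply: ler_wpM2l => //; lra.
  lra.
have [AD0|AD0] := eqVneq (A + D) 0.
  have -> : A = 0 by lra.
  have -> : D = 0 by lra.
  by rewrite mulr0 mul0r !addr0 mulrC ler_wpM2r.
have AD1 : 0 < A + D by rewrite lt_neqAle eq_sym AD0 addr_ge0.
(* Multiplying by [A + D] turns the difference of square roots into a difference of squares,
   divisible by [delta - a]. *)
suff : 0 <= (A + D) * (c * (delta - a) - s * (A - D)) by rewrite pmulr_rge0//; lra.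
have -> : (A + D) * (c * (delta - a) - s * (A - D)) =
   (delta - a) * (c * (A + D)) - s * (A ^+ 2 - D ^+ 2) by ring.
rewrite A2 D2.
have -> : eps ^+ 2 - a ^+ 2 - (eps ^+ 2 - delta ^+ 2) =
    (delta - a) * (delta + a) by ring.
have := ler_wpM2l (_ : 0 <= delta - a) h; rewrite subr_ge0 => /(_ ad); lra.
Qed.

(** * Extremal admissible perturbations *)

Section StrongAdv.
Variables (R : realType) (d : nat) (w mu0 : 'rV[R]_d) (eps delta : R).
Hypotheses (w0 : w != 0) (mu01 : dotv mu0 mu0 = 1).
Hypotheses (eps0 : 0 < eps) (delta0 : 0 <= delta).

(** [c] and [s] are the cosine and sine of the angle; [q] is the part of [w] orthogonal to [mu0], of
    length [Q = W * s]. *)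
Let p := dotv w mu0.
Let W := enorm w.
Let c := `|p| / W.
Let s := Num.sqrt (1 - c ^+ 2).
Let q := w - p *: mu0.
Let Q := enorm q.
Let g := g_fun eps delta (acos c).

Let W0 : 0 < W := enorm_gt0 w0.

Let c0 : 0 <= c. Proof. by rewrite divr_ge0// ltW. Qed.

Let Q2 : Q ^+ 2 = W ^+ 2 - p ^+ 2.
Proof.
rewrite !sqr_enorm /q !(dotvDl, dotvDr, dotvNl, dotvNr, dotvZl, dotvZr) mu01.
by rewrite (dotvC mu0 w) -/p; ring.
Qed.

Let cW : `|p| = W * c. Proof. by rewrite /c mulrC divfK// gt_eqF. Qed.

Let c1 : c <= 1.
Proof.
rewrite ler_pdivrMr// mul1r -ler_sqr ?nnegrE ?(ltW W0)// real_normK ?num_real//.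
by rewrite -subr_ge0 -Q2 sqr_ge0.
Qed.

Let s0 : 0 <= s := sqrtr_ge0 _.

Let cs1 : c ^+ 2 + s ^+ 2 = 1.
Proof. by rewrite sqr_sqrtr ?subr_ge0 ?expr_le1// addrC subrK. Qed.

Let QE : Q = W * s.
Proof.
apply/eqP; rewrite -(@eqrXn2 _ 2) ?mulr_ge0 ?enorm_ge0// Q2 exprMn.
by rewrite -[p ^+ 2]real_normK ?num_real// cW exprMn -[X in X - _]mulr1 -cs1;
  apply/eqP; ring.
Qed.

Let gE : g = Num.min (eps * c) delta * c +
  Num.sqrt (eps ^+ 2 - Num.min (eps * c) delta ^+ 2) * s.
Proof.
have c11 : -1 <= c <= 1 by rewrite c1 andbT (le_trans _ c0)// lerN10.
by rewrite /g /g_fun acosK ?in_itv//= sin_acos.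
Qed.

Let b_ge0 : 0 <= Num.min (eps * c) delta.
Proof. by rewrite le_min delta0 mulr_ge0// ltW. Qed.

Let b_eps : Num.min (eps * c) delta <= eps.
Proof. by rewrite ge_min ler_piMr// ltW. Qed.

Lemma g_fun_acos_ge0 : 0 <= g.
Proof. by rewrite gE addr_ge0// mulr_ge0// sqrtr_ge0. Qed.

(** Splitting [v] into [a *: mu0] and an orthogonal [r] gives w . v = p a + q . r. Cauchy-Schwarz
    bounds this by [W] times the left-hand side of [g_fun_max] at |a|. *)
Lemma dotv_le_g_fun (v : 'rV[R]_d) :
  enorm v <= eps -> `|dotv v mu0| <= delta -> dotv w v <= W * g.
Proof.
move=> ve vd; set a := dotv v mu0 in vd.
pose r := v - a *: mu0.
have r2 : enorm r ^+ 2 = enorm v ^+ 2 - a ^+ 2.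
  rewrite !sqr_enorm /r !(dotvDl, dotvDr, dotvNl, dotvNr, dotvZl, dotvZr) mu01.
  by rewrite (dotvC mu0 v) -/a; ring.
have ae : `|a| <= eps.
  rewrite -ler_sqr ?nnegrE ?(ltW eps0)// real_normK ?num_real//.
  have := sqr_ge0 (enorm r); rewrite r2 subr_ge0 => /le_trans; apply.
  by rewrite ler_sqr ?nnegrE ?enorm_ge0// ltW.
have rle : enorm r <= Num.sqrt (eps ^+ 2 - `|a| ^+ 2).
  rewrite -ler_sqr ?nnegrE ?enorm_ge0 ?sqrtr_ge0// r2.
  rewrite (@sqr_sqrtr _ (eps ^+ 2 - _)); last first.
    by rewrite subr_ge0 ler_sqr ?nnegrE ?(ltW eps0).
  by rewrite real_normK ?num_real// lerD2r ler_sqr ?nnegrE ?enorm_ge0 ?(ltW eps0).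
have -> : dotv w v = p * a + dotv q r.
  rewrite /q /r !(dotvDl, dotvDr, dotvNl, dotvNr, dotvZl, dotvZr) mu01.
  by rewrite (dotvC mu0 v) -/a -/p; ring.
apply: (@le_trans _ _ (W * (c * `|a| + s * Num.sqrt (eps ^+ 2 - `|a| ^+ 2)))).
  rewrite (_ : W * _ = `|p| * `|a| + Q * Num.sqrt (eps ^+ 2 - `|a| ^+ 2)); last first.
    by rewrite cW QE; ring.
  rewrite lerD//.
    by rewrite -normrM ler_norm.
  by apply: le_trans (dotv_le _ _) _; rewrite ler_wpM2l// enorm_ge0.
by rewrite gE ler_pM2l//; apply: g_fun_max => //; exact: ltW.
Qed.

(** The maximiser has a component of size min(eps c, delta) along [mu0], with the sign of [p], and
    spends the remaining length along [q]. *)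
Lemma dotv_eq_g_fun : exists v : 'rV[R]_d,
  [/\ enorm v <= eps, `|dotv v mu0| <= delta & dotv w v = W * g].
Proof.
set be := Num.min (eps * c) delta.
pose h := Num.sqrt (eps ^+ 2 - be ^+ 2).
have h2 : h ^+ 2 = eps ^+ 2 - be ^+ 2.
  by rewrite sqr_sqrtr// subr_ge0 ler_sqr ?nnegrE// ltW.
have [u [umu0 uw uu]] : exists u,
    [/\ dotv u mu0 = 0, dotv w u = Q ^+ 2 & dotv u u = Q ^+ 2].
  exists q; split; last by rewrite sqr_enorm.
    by rewrite dotvDl dotvNl dotvZl mu01 mulr1 subrr.
  by rewrite dotvDr dotvNr dotvZr Q2 sqr_enorm -/p; ring.
(* At [p = 0] the value 1 keeps [sg * sg = 1]. *)
pose sg : R := if 0 <= p then 1 else -1.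
have sgp : sg * p = `|p|.
  by rewrite /sg; case: ger0P => _; rewrite ?mul1r ?mulN1r.
have sg2 : sg * sg = 1 by rewrite /sg; case: ifP; rewrite ?mulr1// mulrNN mulr1.
(* If [Q = 0], then [h / Q] is 0 by convention and the second term vanishes; its share of [W * g] is
   zero as well, because then [s = 0]. *)
exists ((sg * be) *: mu0 + (h / Q) *: u); split.
- rewrite -ler_sqr ?nnegrE ?enorm_ge0 ?(ltW eps0)// sqr_enorm.
  rewrite !(dotvDl, dotvDr, dotvNl, dotvNr, dotvZl, dotvZr) mu01 (dotvC mu0) umu0 uu.
  rewrite [leLHS](_ : _ = (sg * sg) * be ^+ 2 + h ^+ 2 * (Q / Q) ^+ 2); last first.
    by ring.
  rewrite sg2 mul1r h2; have [->|Q0] := eqVneq Q 0.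
    by rewrite mul0r expr0n mulr0 addr0 ler_sqr ?nnegrE ?(ltW eps0).
  by rewrite divff// expr1n mulr1 addrC subrK.
- rewrite dotvDl !dotvZl mu01 umu0 mulr0 addr0 mulr1 normrM.
  have -> : `|sg| = 1 by rewrite /sg; case: ifP; rewrite ?normrN normr1.
  by rewrite mul1r ger0_norm// ge_min lexx orbT.
- rewrite dotvDr !dotvZr uw -/p.
  have -> : sg * be * p + h / Q * Q ^+ 2 = be * (sg * p) + h * (Q * (Q / Q)).
    by ring.
  rewrite sgp cW gE.
  have -> : Q * (Q / Q) = Q.
    by have [->|?] := eqVneq Q 0; rewrite ?mul0r// divff ?mulr1.
  by rewrite QE -/be -/h; ring.
Qed.

(** An admissible move changes the score by at most [W * g], and an extremal [v] attains this in
    either direction. Score 0 belongs to class minus, which makes one bound weak and the other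
    strict. *)
Lemma strong_advP (b : R) (x : 'rV[R]_d) :
  (exists x', strong_adv w b mu0 eps delta x x') <->
  if lin_cls w b x then dotv w x + b <= W * g else - (W * g) < dotv w x + b.
Proof.
have [v [ve vd vg]] := dotv_eq_g_fun.
have advE (x' : 'rV[R]_d) : dotv w x' = dotv w x - dotv w (x - x').
  by rewrite dotvDr dotvNr; ring.
rewrite /strong_adv /lin_cls; case: ltP => hx; split.
- move=> [x' [xe [xd]]]; rewrite eqb_id -leNgt advE => hx'.
  by have := dotv_le_g_fun xe xd; lra.
- move=> hg; exists (x - v); rewrite subKr; split => //; split => //.
  by rewrite eqb_id -leNgt dotvDr dotvNr vg; lra.
- move=> [x' [xe [xd]]]; rewrite eqbF_neg negbK advE => hx'.
  have := @dotv_le_g_fun (- (x - x')); rewrite enormN dotvNl normrN => /(_ xe xd).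
  by rewrite dotvNr; lra.
- move=> hg; exists (x + v); rewrite opprD addNKr enormN dotvNl normrN.
  split => //; split => //.
  by rewrite eqbF_neg negbK dotvDr vg; lra.
Qed.

End StrongAdv.

(** * Linear combinations of independent standard normal variables *)

Section Law.
Variables (R : realType) (dT : measure_display) (T : measurableType dT).
Variables (P : probability T R) (d : nat) (D : set T) (Z : 'I_d -> T -> R).
Hypothesis mD : measurable D.
Hypothesis mZ : forall k, measurable_fun setT (Z k).
Hypothesis ZE : forall A : 'I_d -> set R, (forall k, measurable (A k)) ->
  P (D `&` \bigcap_(k in [set: 'I_d]) (Z k @^-1` A k)) =
  (P D * \prod_(k < d) normal_prob 0 1 (A k))%E.
Variable a : 'I_d -> R.

Let S (J : seq 'I_d) t := \sum_(k <- J) a k * Z k t.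
Let r (J : seq 'I_d) := Num.sqrt (\sum_(k <- J) a k ^+ 2).

Let mS J : measurable_fun setT (S J : T -> measurableTypeR R).
Proof. by apply: measurable_sum => k; apply: measurable_funM. Qed.

Let mpre (f : T -> measurableTypeR R) A : measurable_fun setT f ->
  measurable A -> measurable (f @^-1` A).
Proof. by move=> mf mA; rewrite -[_ @^-1` _]setTI; exact: mf. Qed.

(* The constraints [A k] on the coordinates outside [J] are what lets the
   induction see the next coordinate as independent of [S J]. *)
Let S_law (J : seq 'I_d) : uniq J -> forall (A : 'I_d -> set R) (E : set R),
  (forall k, measurable (A k)) -> (forall k, k \in J -> A k = setT) ->
  measurable E ->
  P (D `&` \bigcap_(k in [set: 'I_d]) (Z k @^-1` A k) `&` S J @^-1` E) =
  (P D * \prod_(k < d) normal_prob 0 1 (A k) *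
     normal_prob 0 1 ((fun z => r J * z)%R @^-1` E))%E.
Proof.
elim: J => [_ A E mA _ mE|j J IH /= /andP[jJ uJ] A E mA AT mE].
  rewrite /S /r big_nil sqrtr0.
  (* With no terms the sum is 0, so both events are full or empty according to whether 0 lies in
     [E]. *)
  have [E0|E0] := pselect (E 0).
    have -> : (fun t => \sum_(k <- [::]) a k * Z k t) @^-1` E = setT.
      by apply/seteqP; split => t //=; rewrite big_nil.
    have -> : (fun z => 0 * z) @^-1` E = setT.
      by apply/seteqP; split => t //=; rewrite mul0r.
    rewrite setIT ZE//.
    rewrite -[LHS]mule1; congr (_ * _)%E; apply/esym.
    exact: (@probability_setT _ _ _ (normal_prob 0 1)).
  have -> : (fun t => \sum_(k <- [::]) a k * Z k t) @^-1` E = set0.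
    by apply/seteqP; split => t //=; rewrite big_nil.
  have -> : (fun z => 0 * z) @^-1` E = set0.
    by apply/seteqP; split => t //=; rewrite mul0r.
  rewrite setI0 measure0 -[LHS](mule0 (P D * \prod_(k < d) normal_prob 0 1 (A k))%E).
  by congr (_ * _)%E; apply/esym; exact: (@measure0 _ _ _ (normal_prob 0 1)).
pose D' := D `&` \bigcap_(k in [set: 'I_d]) (Z k @^-1` A k).
have mD' : measurable D'.
  apply: measurableI => //; apply: fin_bigcap_measurable => // k _.
  exact: (mpre (mZ k) (mA k)).
pose c := (P D * \prod_(k < d) normal_prob 0 1 (A k))%E.
(* On [D'] the laws of [S J] and [Z j] factorise: since [A j] is [setT] and [j] is not in [J], the
   event on [Z j] can enter the induction hypothesis as the constraint at [j]. *)
have pairE (B F : set R) : measurable B -> measurable F ->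
    P (D' `&` (S J @^-1` B `&` Z j @^-1` F)) =
    (c * normal_prob 0 1 ((fun z => r J * z)%R @^-1` B) * normal_prob 0 1 F)%E.
  move=> mB mF.
  pose A' k := if k == j then F else A k.
  have -> : D' `&` (S J @^-1` B `&` Z j @^-1` F) =
    D `&` \bigcap_(k in [set: 'I_d]) (Z k @^-1` A' k) `&` S J @^-1` B.
    apply/seteqP; split => t /=.
      move=> [[Dt At] [Bt Ft]]; split => //; split => // k _ /=.
      by rewrite /A'; case: eqP => [->|_] //; exact: At.
    move=> [[Dt At] Bt]; split; [split => // k _ /=|split => //].
      have := At k I; rewrite /A'/=; case: eqP => [-> _|//].
      by rewrite AT ?mem_head.
    by have := At j I; rewrite /A'/= eqxx.
  rewrite IH//; last 2 first.
    by move=> k; rewrite /A'; case: ifP.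
    move=> k kJ; rewrite /A'; case: eqP => [kj|_]; first by rewrite -kj kJ in jJ.
    by apply: AT; rewrite in_cons kJ orbT.
  rewrite /c (bigD1 j)//= [in RHS](bigD1 j)//= /A' eqxx.
  rewrite AT ?mem_head//.
  have -> : normal_prob 0 1 [set: R] = 1%E :> \bar R.
    exact: (@probability_setT _ _ _ (normal_prob 0 1)).
  rewrite mul1e (eq_bigr (fun k => normal_prob 0 1 (A k))); last first.
    by move=> k kj; rewrite (negbTE kj).
  by rewrite (muleC (normal_prob 0 1 F)) !muleA; exact: muleAC.
have cfin : c \is a fin_num.
  rewrite fin_numM ?fin_num_measure// prode_fin_num// => k _.
  exact: (fin_num_measure (normal_prob 0 1) _ (mA k)).
have c0 : 0 <= fine c.
  by rewrite fine_ge0// mule_ge0// prode_ge0// => k _; exact: measure_ge0.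
have mr : measurable_fun [set: measurableTypeR R]
    ((fun z => r J * z) : measurableTypeR R -> measurableTypeR R).
  exact: (@measurable_funM _ _ _ _ (cst (r J)) id).
pose fr : {mfun measurableTypeR R >-> measurableTypeR R} :=
  HB.pack (fun z : measurableTypeR R => r J * z : measurableTypeR R)
    (isMeasurableFun.Build _ _ _ _ _ mr).
pose m1 : {finite_measure set (measurableTypeR R) -> \bar R} :=
  mscale (NngNum c0) (distribution (normal_prob 0 1) fr).
pose SZ t : measurableTypeR R * measurableTypeR R := (S J t, Z j t).
have mSZ : measurable_fun setT SZ.
  exact: (measurable_fun_pair (mS J) (mZ j)).
have [nu nuE] : exists nu : {measure set
      (measurableTypeR R * measurableTypeR R) -> \bar R},
    forall C, nu C = P (D' `&` SZ @^-1` C).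
  unshelve eexists (pushforward (mrestr P mD') SZ : {measure set _ -> \bar R}).
    exact: mSZ.
  by move=> C; rewrite setIC.
have nuX (B F : set (measurableTypeR R)) : measurable B -> measurable F ->
    nu (B `*` F) = (m1 B * normal_prob 0 1 F)%E.
  move=> mB mF; rewrite nuE (pairE _ _ mB mF) -(fineK cfin).
  by [].
pose C : set (measurableTypeR R * measurableTypeR R) :=
  (fun z => 1 * z.1 + a j * z.2) @^-1` E.
have mC : measurable C.
  by rewrite -[C]setTI; exact: (@measurable_lincomb R 1 (a j)).
have -> : P (D' `&` S (j :: J) @^-1` E) = nu C.
  rewrite nuE; congr (P (_ `&` _)).
  by apply/seteqP; split => t; rewrite /C/= /S big_cons mul1r addrC.
(* [nu] is the joint law of [S J] and [Z j] on [D']; agreement on rectangles makes it a product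
   measure, so the two-variable result applies. *)
rewrite -(product_measure_unique nuX mC).
have mx : measurable_fun [set: measurableTypeR R]
    (normal_prob 0 1 \o xsection C) by exact: measurable_fun_xsection.
rewrite /product_measure1/= ge0_integral_mscale//=.
rewrite ge0_integral_distribution//=.
rewrite fineK//; congr (_ * _)%E.
have -> : r (j :: J) = Num.sqrt (r J ^+ 2 + a j ^+ 2).
  rewrite /r big_cons sqr_sqrtr 1?addrC//.
  by apply: sumr_ge0 => k _; exact: sqr_ge0.
rewrite -normal_prob_lincomb// /product_measure1/=.
apply: eq_integral => x _; congr normal_prob.
by apply/seteqP; split => y; rewrite /xsection/= !inE/C/= mul1r.
Qed.

(** The case of [S_law] with all indices in the sum and no constraint on any coordinate. *)
Lemma independent_normal_lincomb_law (E : set R) : measurable E ->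
  P (D `&` (fun t => \sum_(k < d) a k * Z k t) @^-1` E) =
  (P D * normal_prob 0 1
     ((fun z => Num.sqrt (\sum_(k < d) a k ^+ 2) * z)%R @^-1` E))%E.
Proof.
move=> mE.
have := S_law (index_enum_uniq _) (fun=> measurableT) (fun _ _ => erefl) mE.
rewrite big1; last first.
  by move=> k _; exact: (@probability_setT _ _ _ (normal_prob 0 1)).
rewrite mule1 => <-; congr (P _); apply/seteqP; split => t /= [].
  by move=> ? ?; split.
by move=> [].
Qed.

End Law.

(** * Probabilities of misclassification and of strong adversarial examples *)

Unset Implicit Arguments.

Theorem theorem2 (R : realType) (dT : measure_display) (T : measurableType dT)
  (P : probability T R) (d : nat) (mup mum : 'rV[R]_d) (sigma : R)
  (Y : T -> bool) (Z : 'I_d -> T -> R) (X : T -> 'rV[R]_d)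
  (w : 'rV[R]_d) (b eps delta : R) :
  mup != mum -> 0 < sigma ->
  (* label: Y = true means class +, P(Y = +) = P(Y = -) = 1/2 *)
  measurable (Y @^-1` [set true]) ->
  P (Y @^-1` [set true]) = (2^-1)%:E ->
  (* X | Y = i ~ N(mu_i, sigma^2 I_d), realized as X = mu_Y + sigma Z with
     Z_1..Z_d i.i.d. standard normal, independent of Y *)
  (forall k, measurable_fun setT (Z k)) ->
  (forall k A, measurable A -> P (Z k @^-1` A) = normal_prob 0 1 A) ->
  indep_label_coords P Y Z ->
  (forall t, X t = (if Y t then mup else mum) + sigma *: \row_k Z k t) ->
  w != 0 -> 0 < eps -> 0 <= delta ->
  let mu := 2^-1 *: (mup - mum) in
  let mubar := 2^-1 *: (mup + mum) in
  let b' := dotv w mubar + b in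
  let mu0 := (enorm mu)^-1 *: mu in
  let theta := acos (`|dotv w mu0| / enorm w) in
  let g := g_fun eps delta theta in
  let pm := P [set t | lin_cls w b (X t) != Y t] in
  let psadv := P [set t | lin_cls w b (X t) = Y t /\
                          exists x', strong_adv w b mu0 eps delta (X t) x'] in
  let c := 2^-1 * (Phi ((dotv w mu + b') / (enorm w * sigma) - g / sigma)
                 + Phi ((dotv w mu - b') / (enorm w * sigma) - g / sigma)) in
  (psadv = 1%:E - pm - c%:E)%E /\ (psadv + pm = (1 - c)%:E)%E.
Proof.
move=> mupm sigma0 mY PY mZ Zlaw indep XE w0 eps0 delta0 mu mubar b' mu0 theta g
  pm psadv c.
have mu_neq0 : mu != 0 by rewrite scaler_eq0 invr_eq0 pnatr_eq0/= subr_eq0.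
have mu01 : dotv mu0 mu0 = 1.
  by rewrite /mu0 dotvZl dotvZr -sqr_enorm; field; rewrite gt_eqF// enorm_gt0.
pose W := enorm w; pose G := W * g.
have W0 : 0 < W by exact: enorm_gt0.
have G0 : 0 <= G.
  by rewrite mulr_ge0 ?(ltW W0)//; exact: g_fun_acos_ge0.
(* The mean scores of the two classes. *)
pose A1 := dotv w mup + b; pose A0 := dotv w mum + b.
pose h t := \sum_(k < d) w 0 k * Z k t.
have lE t : dotv w (X t) + b = (if Y t then A1 else A0) + sigma * h t.
  rewrite XE dotvDr dotvZr (_ : dotv w (\row_k Z k t) = h t); last first.
    by apply: eq_bigr => k _; rewrite mxE.
  by case: (Y t); rewrite addrAC.
pose D1 := Y @^-1` [set true]; pose D0 := Y @^-1` [set false].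
have D0E : D0 = ~` D1.
  by apply/seteqP; split => t; rewrite /D0 /D1/=; case: (Y t) => // /(_ erefl).
have mD0 : measurable D0 by rewrite D0E; exact: measurableC.
have PD0 : P D0 = (2^-1)%:E.
  by rewrite D0E probability_setC// /D1 PY -EFinB; congr EFin; lra.
have mh : measurable_fun setT h.
  by apply: measurable_sum => k; exact: measurable_funM.
have law B E : measurable (Y @^-1` B) -> measurable E ->
    P (Y @^-1` B `&` h @^-1` E) =
    (P (Y @^-1` B) * normal_prob 0 1 ((fun z => W * z)%R @^-1` E))%E.
  move=> mB mE; rewrite (independent_normal_lincomb_law mB mZ)//.
  move=> A mA; rewrite (indep B A mA); congr (_ * _)%E.
  by apply: eq_bigr => k _; rewrite Zlaw.
have leE (A u x : R) : (A + sigma * x <= u) = (x <= (u - A) / sigma).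
  by rewrite ler_pdivlMr// lerBrDl mulrC.
have leW (u z : R) : (W * z <= u / sigma) = (z <= u / (W * sigma)).
  by rewrite -ler_pdivlMl// invfM mulrCA.
have mle A u : measurable [set t | A + sigma * h t <= u].
  rewrite (_ : [set t | _] = h @^-1` `]-oo, (u - A) / sigma]); last first.
    by apply/seteqP; split => t /=; rewrite in_itv/= leE.
  by rewrite -[_ @^-1` _]setTI; exact: mh.
have mgt A u : measurable [set t | u < A + sigma * h t].
  rewrite (_ : [set t | _] = ~` [set t | A + sigma * h t <= u]).
    exact/measurableC/mle.
  by apply/seteqP; split => t /=; rewrite ltNge => /negP.
have P1 : P (D1 `&` [set t | A1 + sigma * h t <= G]) =
    (2^-1 * Phi ((G - A1) / (W * sigma)))%:E.
  rewrite (_ : [set t | _] = h @^-1` `]-oo, (G - A1) / sigma]); last first.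
    by apply/seteqP; split => t /=; rewrite in_itv/= leE.
  rewrite law// PY EFinM -normal_prob_PhiE; congr (_ * normal_prob 0 1 _)%E.
  apply/seteqP; split => z /=;
    by rewrite !in_itv/= leW.
have P0 : P (D0 `&` [set t | - G < A0 + sigma * h t]) =
    (2^-1 * (1 - Phi ((- G - A0) / (W * sigma))))%:E.
  rewrite (_ : [set t | _] = h @^-1` `](- G - A0) / sigma, +oo[); last first.
    by apply/seteqP; split => t /=; rewrite in_itv/= andbT !ltNge leE.
  rewrite law// PD0 EFinM -normal_prob_PhiC; congr (_ * normal_prob 0 1 _)%E.
  apply/seteqP; split => z /=;
    by rewrite !in_itv/= !andbT !ltNge leW.
pose E1 := [set t | lin_cls w b (X t) != Y t].
pose E2 := [set t | lin_cls w b (X t) = Y t /\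
                    exists x', strong_adv w b mu0 eps delta (X t) x'].
(* [U] is the event of being misclassified or having an adversarial example. *)
pose U := (D1 `&` [set t | A1 + sigma * h t <= G]) `|`
          (D0 `&` [set t | - G < A0 + sigma * h t]).
have mE1 : measurable E1.
  rewrite (_ : E1 = (D1 `&` [set t | A1 + sigma * h t <= 0]) `|`
      (D0 `&` [set t | 0 < A0 + sigma * h t])).
    by apply: measurableU; apply: measurableI.
  apply/seteqP; split => t; rewrite /E1 /D1 /D0/= /lin_cls lE; case: (Y t).
  - by rewrite eqb_id -leNgt; left.
  - by rewrite eqbF_neg negbK; right.
  - by rewrite eqb_id -leNgt => -[[]|[]].
  - by rewrite eqbF_neg negbK => -[[]|[]].
have mU : measurable U by apply: measurableU; apply: measurableI.
(* On correctly classified points [strong_advP] turns the existence of an adversarial example into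
   membership in [U]; this also yields the measurability of [E2]. *)
have E2E : E2 = U `\` E1.
  apply/seteqP; split => t.
    move=> [ct]; move/(strong_advP w0 mu01 eps0 delta0); rewrite -/theta -/g -/W -/G.
    rewrite lE ct /U /E1 /D1 /D0/= ct eqxx.
    by case: (Y t) => ?; split => //; [left|right].
  move=> [Ut /negP]; rewrite negbK => /eqP ct; split => //.
  apply/(strong_advP w0 mu01 eps0 delta0); rewrite -/theta -/g -/W -/G.
  rewrite lE ct; move: Ut; rewrite /U /D1 /D0/=.
  by case: (Y t) => -[[]|[]].
(* Misclassification means crossing the threshold 0, and [G >= 0]. *)
have E1U : E1 `<=` U.
  move=> t; rewrite /E1 /U /D1 /D0/= /lin_cls lE; case: (Y t).
  - by rewrite eqb_id -leNgt => ?; left; split => //; lra.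
  - by rewrite eqbF_neg negbK => ?; right; split => //; lra.
have mE2 : measurable E2 by rewrite E2E; exact: measurableD.
have PU : (P E2 + P E1)%E = P U.
  rewrite -measureU//.
    by rewrite E2E setDKU.
  by rewrite E2E setDKI.
have sumE : (psadv + pm = (1 - c)%:E)%E.
  rewrite [LHS]PU measureU//; last 3 first.
  - exact: measurableI.
  - exact: measurableI.
  - by rewrite /D0 /D1; apply/seteqP; split => t //= [[-> _] []].
  rewrite [X in (X + _)%E]P1 [X in (_ + X)%E]P0 -EFinD; congr EFin.
  rewrite /c.
  (* Here w . mu + b' is [A1] and, below, w . mu - b' is [- A0]. *)
  have -> : (dotv w mu + b') / (enorm w * sigma) - g / sigma =
      - ((G - A1) / (W * sigma)).
    rewrite /G /A1 /b' /mu /mubar !dotvZr !dotvDr dotvNr -/W.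
    by field; rewrite !gt_eqF.
  have -> : (dotv w mu - b') / (enorm w * sigma) - g / sigma =
      (- G - A0) / (W * sigma).
    rewrite /G /A0 /b' /mu /mubar !dotvZr !dotvDr dotvNr -/W.
    by field; rewrite !gt_eqF.
  by rewrite PhiN; lra.
split => //.
(* Finiteness of [pm] lets the first identity follow from the second by subtraction. *)
have pmfin : pm \is a fin_num by exact: fin_num_measure.
by rewrite addeAC -EFinB -sumE addeK.
Qed.
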